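(* Let $j,k\in\mathbb{Z}_{>0}$. Then $$\sum_{n=1}^{\infty}\frac{\binom{2n}{n}}{n^k4^n}\sum_{n\ge n_1\ge\cdots\ge n_j\ge 1}\frac{4^{n_j}}{\binom{2n_j}{n_j}}\prod_{i=1}^j\frac{1}{n_i^2}=\frac{2^{k+1}}{(k-1)!}\int_0^1\frac{\ln^{k-1}\!\left(\frac{1+t}{2\sqrt{t}}\right)\chi_{2j}(t)}{t}\,dt,$$ where the inner sum is over integers $n_1,\dots,n_j$.
   Context: The Legendre chi function is $\chi_s(x):=\sum_{n=1}^{\infty}\frac{x^{2n-1}}{(2n-1)^s}$ for $|x|<1$, $s\in\mathbb{C}$ (also for $x=\pm1$ if $\Re(s)>1$). $\ln^{k-1}(\cdot)$ denotes the $(k-1)$-th power of the natural logarithm. *)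

(* Defs.v *)
From mathcomp Require Import all_boot all_order all_algebra.
From mathcomp Require Import all_classical all_reals all_analysis.

Set Implicit Arguments.
Unset Strict Implicit.
Unset Printing Implicit Defensive.

Import Order.TTheory GRing.Theory Num.Theory.
Import numFieldNormedType.Exports.

Local Open Scope classical_set_scope.
Local Open Scope ring_scope.

(* Only integral orders [s] are needed, so the power is the ring power. *)
Definition legendre_chi (R : realType) (s : nat) (x : R) : R :=
  limn (fun N : nat =>
    \sum_(1 <= n < N) x ^+ (2 * n - 1) / (2 * n - 1)%:R ^+ s).

(* The tuple [m] is (n_1, ..., n_j); its entries are bounded by [n] through
   their type.  [path geq n m] reads n >= n_1 >= ... >= n_j, and [last n m]
   is n_j as soon as [0 < j]. *)
Definition nested_sum (R : realType) (j n : nat) : R :=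
  \sum_(m : j.-tuple 'I_n.+1 |
          let s := map val m in path geq n s && (1 <= last n s)%N)
    let nj := last n (map val m) in
    4 ^+ nj / 'C(2 * nj, nj)%:R * \prod_(i < j) ((tnth m i)%:R ^+ 2)^-1.

Definition chi_integrand (R : realType) (j k : nat) (t : R) : R :=
  ln ((1 + t) / (2 * Num.sqrt t)) ^+ k.-1 * legendre_chi (2 * j) t / t.

(* Main.v *)
(* Writing S_j(n) for the nested sum, induction on j and n gives the finite
   identity, for n >= 1,
     C(2n, n) S_j(n) = 4 sum_(p odd) C(2n, n + p) / p^(2j),
   because (n+1)^2 - p^2 turns C(2n+2, n+1+p) into (2n+2)(2n+1) C(2n, n+p).
   The left-hand side of the theorem is thus a double series over n and odd p
   with nonnegative terms.  For fixed p, put kappa = 4t / (1+t)^2; then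
     sum_n C(2n, n+p) (kappa / 4)^n = t^p (1+t) / (1-t),
   and kappa'/kappa = (1-t) / (t (1+t)), so that
     t^(p-1) = sum_n C(2n, n+p) 4^-n kappa^(n-1) kappa'.
   The logarithm in the integrand is - ln kappa / 2, and its k-1-st power
   integrates against kappa^(n-1) kappa' to (k-1)! 2^(1-k) / n^k.  Tonelli's
   theorem, applied to the integral and to the double series, concludes. *)
Require Import Defs.
From mathcomp Require Import all_boot all_order all_algebra.
From mathcomp Require Import all_classical all_reals all_analysis.
From mathcomp Require Import measurable_realfun.
From mathcomp Require Import ring lra zify.

Import Order.TTheory GRing.Theory Num.Theory.
Import numFieldNormedType.Exports.

Local Open Scope classical_set_scope.
Local Open Scope ring_scope.

(** * Binomial identities and the closed form of the nested sum *)

(** Two absorption steps, one at the lower index and one at its complement, contribute the factor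
    (n+1+p)(n+1-p). The difference of squares is spread over both sides to avoid truncated
    subtraction. *)
Lemma bin_central_succ (n p : nat) :
  ('C(2 * n.+1, n.+1 + p) * (n.+1 * n.+1) =
   'C(2 * n.+1, n.+1 + p) * (p * p) + (2 * n.+1) * (2 * n).+1 * 'C(2 * n, n + p))%N.
Proof.
have e1 := mul_bin_diag (2 * n).+2 (n + p).
have e2 := mul_bin_down (2 * n).+1 (n + p).
have -> : (2 * n.+1 = (2 * n).+2)%N by lia.
rewrite !succnK in e1 e2; rewrite !addSn.
case: (leqP p n.+1) => [pn|pn]; last first.
  by rewrite !bin_small; lia.
have e4 : ((2 * n).+1 - (n + p) = n.+1 - p)%N by lia.
rewrite e4 in e2.
have e5 : ((2 * n).+2 * (2 * n).+1 * 'C(2 * n, n + p) =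
    (n.+1 - p) * ((n + p).+1 * 'C((2 * n).+2, (n + p).+1)))%N.
  by rewrite -mulnA e2 mulnCA e1.
rewrite e5.
move: 'C(_, _) => c; have [q nq] : exists q, n.+1 = (q + p)%N.
  by exists (n.+1 - p)%N; rewrite subnK.
by rewrite -addSn nq addnK; ring.
Qed.

Lemma bin_central_pascal (n p : nat) :
  'C(2 * n.+1, n.+1 + p.+1) =
  ('C(2 * n, n + p) + 'C(2 * n, n + p.+1) * 2 + 'C(2 * n, n + p.+2))%N.
Proof.
have -> : (2 * n.+1 = (2 * n).+2)%N by lia.
rewrite !addSn !addnS !binS; lia.
Qed.

(** Pascal's rule applied twice at the centre reaches both neighbours of C(2n, n); they are equal by
    symmetry, which doubles the second term. *)
Lemma bin_central_pascal0 (n : nat) :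
  'C(2 * n.+1, n.+1) = ('C(2 * n, n) * 2 + 'C(2 * n, n.+1) * 2)%N.
Proof.
have -> : (2 * n.+1 = (2 * n).+2)%N by lia.
rewrite !binS; case: n => [|n] //.
rewrite binS.
have -> : 'C(2 * n.+1, n) = 'C(2 * n.+1, n.+2).
  by rewrite -bin_sub; [congr 'C(_, _); lia|lia].
lia.
Qed.

(** By Pascal's rule each summand is a pair of consecutive entries of row 2n+1. Together the pairs
    exhaust the upper half of that row, whose sum is half of 2^(2n+1). *)
Lemma sum_bin_odd_shift (n M : nat) : (n < M)%N ->
  (4 * \sum_(m < M) 'C(2 * n.+1, n.+1 + (2 * m).+1) = 4 ^ n.+1)%N.
Proof.
move=> nM.
have e2 : (2 * n.+1 = (2 * n).+2)%N by lia.
have pair : forall N, (\sum_(m < N) 'C(2 * n.+1, n.+1 + (2 * m).+1) =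
    \sum_(i < 2 * N) 'C((2 * n).+1, n.+1 + i))%N.
  elim=> [|N IH]; first by rewrite !big_ord0.
  have -> : (2 * N.+1 = (2 * N).+2)%N by lia.
  rewrite !big_ord_recr /= IH -addnA; congr (_ + _)%N.
  by rewrite e2 !addnS binS addnC.
rewrite pair.
have half : (\sum_(i < n.+1) 'C((2 * n).+1, n.+1 + i) =
             \sum_(i < n.+1) 'C((2 * n).+1, i))%N.
  rewrite (reindex_inj rev_ord_inj) /=; apply: eq_bigr => i _.
  rewrite -bin_sub; last by have := ltn_ord i; lia.
  by congr 'C(_, _); have := ltn_ord i; lia.
have tot : (\sum_(i < n.+1 + n.+1) 'C((2 * n).+1, i) = 2 ^ (2 * n).+1)%N.
  have := Pascal 1 1 (2 * n).+1; rewrite addn1 addnn => ->.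
  have -> : (n.+1.*2 = (2 * n).+2)%N by lia.
  by apply: eq_bigr => i _; rewrite !exp1n !muln1.
rewrite big_split_ord /= -half addnn in tot.
have -> : (2 * M = n.+1 + (2 * M - n.+1))%N by lia.
rewrite big_split_ord /= [X in (_ + X)%N]big1 ?addn0; last first.
  by move=> i _; rewrite bin_small //; lia.
have -> : (4 = 2 ^ 2)%N by [].
rewrite -expnM e2.
rewrite [RHS]expnS.
move: tot; set s := (\sum_(_ < _) _)%N => tot.
rewrite expnS -tot; lia.
Qed.

(* [nested_sum] with the bound on the entries of the tuple decoupled from the
   upper limit [n], which makes it recursive in [j]. *)
Definition nested_sum_bounded (R : realType) (B j n : nat) : R :=
  \sum_(m : j.-tuple 'I_B.+1 |
          let s := map val m in path geq n s && (1 <= last n s)%N)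
    let nj := last n (map val m) in
    4 ^+ nj / 'C(2 * nj, nj)%:R * \prod_(i < j) ((tnth m i)%:R ^+ 2)^-1.

Lemma nested_sum_bounded0 (R : realType) (B n : nat) :
  nested_sum_bounded R B 0 n =
  if (0 < n)%N then 4 ^+ n / 'C(2 * n, n)%:R else 0.
Proof.
rewrite /nested_sum_bounded; case: ifP => n0.
  rewrite (big_pred1 [tuple]) /=; first by rewrite big_ord0 mulr1.
  by move=> m; rewrite tuple0 /= n0; apply/esym/eqP.
by rewrite big_pred0 // => m; rewrite tuple0 /= n0.
Qed.

Lemma nested_sum_boundedS (R : realType) (B j n : nat) :
  nested_sum_bounded R B j.+1 n =
  \sum_(i < B.+1 | (i <= n)%N) (i%:R ^+ 2)^-1 * nested_sum_bounded R B j i.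
Proof.
rewrite /nested_sum_bounded.
under [RHS]eq_bigr do rewrite mulr_sumr.
rewrite pair_big_dep /=.
pose h (p : 'I_B.+1 * j.-tuple 'I_B.+1) := cons_tuple p.1 p.2.
have hbij : bijective h.
  exists (fun m => (thead m, behead_tuple m)).
    by case=> x t; rewrite /h /= theadE; congr pair; apply: val_inj.
  by move=> m; rewrite /h /= [RHS]tuple_eta.
rewrite (reindex h) /=; last exact: onW_bij.
apply: eq_big => [[i m]|[i m] _] /=; first by rewrite andbA.
rewrite big_ord_recl /= mulrCA; congr (_ * (_ * _)).
by apply: eq_bigr => l _; rewrite (tnth_nth i) /= (tnth_nth i).
Qed.

Lemma nested_sum_bounded_recr (R : realType) (B j n : nat) : (n < B)%N ->
  nested_sum_bounded R B j.+1 n.+1 =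
  nested_sum_bounded R B j.+1 n +
  (n.+1%:R ^+ 2)^-1 * nested_sum_bounded R B j n.+1.
Proof.
move=> nB; rewrite !nested_sum_boundedS.
have nB' : (n.+1 < B.+1)%N by [].
rewrite (bigD1 (Ordinal nB')) //= addrC; congr (_ + _).
apply: eq_bigl => i; rewrite -val_eqE /=; lia.
Qed.

Lemma nested_sum_bounded_n0 (R : realType) (B j : nat) :
  nested_sum_bounded R B j 0 = 0.
Proof.
elim: j => [|j IH]; first by rewrite nested_sum_bounded0.
rewrite nested_sum_boundedS big1 // => i; rewrite leqn0 => /eqP ->.
by rewrite IH mulr0.
Qed.

(** The base [j = 0] is [sum_bin_odd_shift]. For the step, [bin_central_succ] at p = 2m+1, divided
    by (n+1)^2 p^(2j+2), shows that each summand on the right obeys the recurrence that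
    [nested_sum_bounded_recr] gives on the left. Since C(2n, n+p) = 0 for p > n, cutting the sum at
    [B] loses nothing. *)
Lemma nested_sum_bounded_closed (R : realType) (B j n : nat) : (n <= B)%N ->
  'C(2 * n, n)%:R * nested_sum_bounded R B j n =
  if (0 < n)%N then
    4 * \sum_(m < B) 'C(2 * n, n + (2 * m).+1)%:R / (2 * m).+1%:R ^+ (2 * j)
  else 0.
Proof.
elim: j n => [|j IHj] n nB.
  rewrite nested_sum_bounded0; case: n nB => [|n] nB /=; first by rewrite mulr0.
  rewrite mulrCA mulfV ?mulr1; last first.
    by rewrite pnatr_eq0 -lt0n bin_gt0; lia.
  under eq_bigr do rewrite muln0 expr0 divr1.
  by rewrite -natr_sum -natrM sum_bin_odd_shift // natrX.
elim: n nB => [|n IHn] nB /=; first by rewrite nested_sum_bounded_n0 mulr0.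
rewrite nested_sum_bounded_recr // mulrDr.
have n1 : n.+1%:R != 0 :> R by rewrite pnatr_eq0.
(* The ratio of consecutive central binomials is [bin_central_succ] at p = 0. *)
have -> : 'C(2 * n.+1, n.+1)%:R * nested_sum_bounded R B j.+1 n =
   (2 * n.+1)%:R * (2 * n).+1%:R / n.+1%:R ^+ 2 *
     ('C(2 * n, n)%:R * nested_sum_bounded R B j.+1 n).
  rewrite [RHS]mulrA; congr (_ * _).
  have := bin_central_succ n 0; rewrite !muln0 add0n !addn0 => /(congr1 (GRing.natmul (1 : R))).
  rewrite !natrM => e; rewrite expr2.
  apply: (mulIf (mulf_neq0 n1 n1)); rewrite e; field.
  by rewrite addrC natr1.
rewrite [X in _ + X]mulrCA IHj // IHn ?(ltnW nB) //.
have -> : (if (0 < n)%N then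
    4 * \sum_(m < B) 'C(2 * n, n + (2 * m).+1)%:R / (2 * m).+1%:R ^+ (2 * j.+1)
  else 0) =
    4 * \sum_(m < B) 'C(2 * n, n + (2 * m).+1)%:R / (2 * m).+1%:R ^+ (2 * j.+1) :> R.
  case: ifP => // /negbT; rewrite -eqn0Ngt => /eqP ->.
  by rewrite big1 ?mulr0 // => m _; rewrite bin_small ?mul0r.
rewrite /= !(mulrCA _ 4) -mulrDr; congr (_ * _).
rewrite !mulr_sumr -big_split /=; apply: eq_bigr => m _.
have m1 : (2 * m).+1%:R != 0 :> R by rewrite pnatr_eq0.
have := bin_central_succ n (2 * m).+1 => /(congr1 (GRing.natmul (1 : R))).
rewrite natrD !natrM.
set c := 'C(_, _)%:R; set d := 'C(_, _)%:R; set p := (2 * m).+1%:R => e.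
rewrite mulnS exprD !expr2.
apply: (mulIf (mulf_neq0 n1 n1)).
have pj : p ^+ (2 * j) != 0 by rewrite expf_neq0.
rewrite [RHS]mulrAC e; move: pj; set pp := p ^+ (2 * j) => pj.
field.
by rewrite pj /= -natrM !nat1r !pnatr_eq0.
Qed.

(** * Generating functions of the binomials C(2n, n+p) *)

Section central_binomial_series.
Context {R : realType}.
Implicit Types (x t : R) (p n : nat).

Let u x p n : R := 'C(2 * n, n + p)%:R * x ^+ n.

Lemma bin_le_exp n m : ('C(n, m) <= 2 ^ n)%N.
Proof.
have [mn|nm] := leqP m n; last by rewrite bin_small.
have := Pascal 1 1 n; rewrite addn1 => ->.
have mn' : (m < n.+1)%N by [].
rewrite (bigD1 (Ordinal mn')) //= !exp1n !muln1; exact: leq_addr.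
Qed.

Lemma bin_term_ge0 x p n : 0 <= x -> 0 <= u x p n.
Proof. by move=> x0; rewrite mulr_ge0 ?exprn_ge0. Qed.

Lemma bin_term_le x p n : 0 <= x -> u x p n <= (4 * x) ^+ n.
Proof.
move=> x0; rewrite exprMn ler_wpM2r ?exprn_ge0 //.
by rewrite -natrX ler_nat (leq_trans (bin_le_exp _ _)) // expnM.
Qed.

Lemma is_cvg_bin_series x p : 0 <= x -> 4 * x < 1 -> cvgn (series (u x p)).
Proof.
move=> x0 x1; apply: (@series_le_cvg _ _ (geometric 1 (4 * x))).
- by move=> n; exact: bin_term_ge0.
- by move=> n /=; rewrite mul1r exprn_ge0 // mulr_ge0.
- by move=> n /=; rewrite mul1r bin_term_le.
- by apply: is_cvg_geometric_series; rewrite ger0_norm // mulr_ge0.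
Qed.

Let A x p := limn (series (u x p)).

Lemma bin_series_ge0 x p : 0 <= x -> 4 * x < 1 -> 0 <= A x p.
Proof.
move=> x0 x1; apply: limr_ge; first exact: is_cvg_bin_series.
by apply: nearW => n; apply: sumr_ge0 => i _; exact: bin_term_ge0.
Qed.

Lemma bin_series_le x p : 0 <= x -> 4 * x < 1 -> A x p <= (1 - 4 * x)^-1.
Proof.
move=> x0 x1; have x1' : `|4 * x| < 1 by rewrite ger0_norm // mulr_ge0.
have := @cvg_geometric_series _ 1 (4 * x) x1'; rewrite mul1r => /cvg_lim <- //.
apply: ler_lim; [exact: is_cvg_bin_series|exact: is_cvg_geometric_series|].
by apply: nearW => n; apply: ler_sum => i _ /=; rewrite mul1r bin_term_le.
Qed.

(** This is [bin_central_pascal] summed against x^(n+1); the term of index 0 on the left is C(0,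
    p+1) = 0. *)
Lemma bin_series_rec x p : 0 <= x -> 4 * x < 1 ->
  A x p.+1 = x * (A x p + 2 * A x p.+1 + A x p.+2).
Proof.
move=> x0 x1; have c q := is_cvg_bin_series x q x0 x1.
have h : (fun n => series (u x p.+1) n.+1) =
    (fun n => x * (series (u x p) n + 2 * series (u x p.+1) n + series (u x p.+2) n)).
  apply/funext => n; rewrite /series /= big_nat_recl // {1}/u bin_small //.
  rewrite mul0r add0r [X in x * (_ + X + _)]mulr_sumr -!big_split /= mulr_sumr.
  apply: eq_bigr => i _; rewrite /u bin_central_pascal !natrD natrM exprS; ring.
apply: (@cvg_unique _ (@Rhausdorff R) (series (u x p.+1) n.+1 @[n --> \oo])).
  by have := c p.+1; rewrite -(cvg_shiftS (series (u x p.+1))).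
rewrite h; apply: cvgMr; apply: cvgD; last exact: c.
by apply: cvgD; [exact: c|apply: cvgMr; exact: c].
Qed.

Lemma bin_series_rec0 x : 0 <= x -> 4 * x < 1 ->
  A x 0 = 1 + x * (2 * A x 0 + 2 * A x 1).
Proof.
move=> x0 x1; have c q := is_cvg_bin_series x q x0 x1.
have h : (fun n => series (u x 0) n.+1) =
    (fun n => 1 + x * (2 * series (u x 0) n + 2 * series (u x 1) n)).
  apply/funext => n; rewrite /series /= big_nat_recl // {1}/u bin0 mul1r.
  congr (_ + _); rewrite !mulr_sumr -!big_split /= mulr_sumr.
  apply: eq_bigr => i _; rewrite /u !addn0 addn1 bin_central_pascal0 !natrD !natrM exprS; ring.
apply: (@cvg_unique _ (@Rhausdorff R) (series (u x 0) n.+1 @[n --> \oo])).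
  by have := c 0%N; rewrite -(cvg_shiftS (series (u x 0))).
rewrite h; apply: cvgD; first exact: cvg_cst.
by apply: cvgMr; apply: cvgD; apply: cvgMr; exact: c.
Qed.

(* With [x = t / (1 + t)^2] the recurrence [bin_series_rec] has characteristic
   roots [t] and [1 / t]; boundedness in [p] excludes the second one. *)
Lemma bin_seriesE t p : 0 < t < 1 ->
  A (t / (1 + t) ^+ 2) p = t ^+ p * ((1 + t) / (1 - t)).
Proof.
move=> /andP[t0 t1]; set x := t / _.
have t1' : 0 < 1 + t by lra.
have xt : x * (1 + t) ^+ 2 = t by rewrite divfK // expf_neq0 // lt0r_neq0.
have x0 : 0 <= x by rewrite divr_ge0 ?exprn_ge0 ?ltW.
have x1 : 4 * x < 1.
  rewrite /x mulrA ltr_pdivrMr ?exprn_gt0 // mul1r.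
  by have : 0 < (1 - t) ^+ 2 by [rewrite exprn_gt0 //; lra]; nra.
(* [D] is the deviation from the solution with root [t]. The recurrence turns into
   [D q = t * D q.+1], hence [D 0 = t ^+ q * D q] for all [q]. *)
pose D q := A x q.+1 - t * A x q.
have DS q : D q = t * D q.+1.
  rewrite /D; have := bin_series_rec x q x0 x1.
  move: (A x q) (A x q.+1) (A x q.+2) => a b c e.
  have : b * (1 + t) ^+ 2 = (x * (1 + t) ^+ 2) * (a + 2 * b + c).
    by rewrite {1}e; ring.
  rewrite xt; nra.
have D0 q : D 0%N = t ^+ q * D q.
  elim: q => [|q ->]; first by rewrite expr0 mul1r.
  by rewrite DS exprSr mulrA.
have D00 : D 0%N = 0.
  (* [K] bounds all [A x q] uniformly in [q], so t^q D(q) tends to 0 and the constant [D 0]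
     vanishes. *)
  pose K := (1 - 4 * x)^-1.
  have K0 : 0 <= K by rewrite invr_ge0; lra.
  have DK q : `|D 0%N| <= 2 * K * t ^+ q.
    rewrite (D0 q) normrM (ger0_norm (exprn_ge0 _ (ltW t0))) mulrC.
    rewrite ler_wpM2r ?exprn_ge0 ?(ltW t0) // /D.
    have := bin_series_le x q x0 x1; have := bin_series_le x q.+1 x0 x1.
    have := bin_series_ge0 x q x0 x1; have := bin_series_ge0 x q.+1 x0 x1.
    rewrite -/K ler_norml; move: (A _ _) (A _ _) => a b *; nra.
  have lim0 : 2 * K * t ^+ n @[n --> \oo] --> (0 : R).
    by apply: cvg_geometric; rewrite ger0_norm // ltW.
  apply/eqP; rewrite -normr_le0 -(cvg_lim (@Rhausdorff R) lim0); apply: limr_ge.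
    exact: cvgP lim0.
  by apply: nearW => n; exact: DK.
have AS q : A x q.+1 = t * A x q.
  have /eqP := D0 q; rewrite D00 eq_sym mulf_eq0 expf_eq0 (gt_eqF t0) andbF /=.
  by rewrite subr_eq0 => /eqP.
elim: p => [|p IH]; last by rewrite AS IH exprS mulrA.
rewrite expr0 mul1r; have := bin_series_rec0 x x0 x1; rewrite AS.
move: (A x 0) => a e.
have t2 : 0 < 1 - t by lra.
apply: (mulIf (lt0r_neq0 t2)); rewrite divfK ?lt0r_neq0 //.
have : a * (1 + t) ^+ 2 =
    (1 + t) ^+ 2 + (x * (1 + t) ^+ 2) * (2 * a + 2 * (t * a)).
  by rewrite {1}e; ring.
rewrite xt => h.
apply: (mulfI (lt0r_neq0 t1')); nra.
Qed.

End central_binomial_series.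

(** * The integral of a power of the logarithm against kappa^n kappa' *)

Section logarithmic_beta_integral.
Context {R : realType}.
Implicit Types (t : R) (n k : nat).

(* [kappa t = (2 sqrt t / (1 + t))^2], so the logarithm in the integrand is
   [ell t = - ln (kappa t) / 2]. *)
Definition kappa t : R := 4 * t / (1 + t) ^+ 2.
Definition dkappa t : R := 4 * (1 - t) / (1 + t) ^+ 3.
Definition ell t : R := - ln (kappa t) / 2.

Lemma kappa_gt0 t : 0 < t -> 0 < kappa t.
Proof. by move=> t0; rewrite divr_gt0 ?exprn_gt0 ?mulr_gt0 ?addr_gt0. Qed.

Lemma kappa_le1 t : 0 < t -> kappa t <= 1.
Proof.
move=> t0; rewrite ler_pdivrMr ?exprn_gt0 ?addr_gt0 // mul1r.
by have := sqr_ge0 (1 - t); nra.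
Qed.

Lemma ell_ge0 t : 0 < t -> 0 <= ell t.
Proof. by move=> t0; rewrite divr_ge0 // oppr_ge0 ln_le0 // kappa_le1. Qed.

Lemma ellE t : 0 < t -> ell t = ln ((1 + t) / (2 * Num.sqrt t)).
Proof.
move=> t0; have s0 : 0 < Num.sqrt t by rewrite sqrtr_gt0.
set y := _ / _; have y0 : 0 < y by rewrite divr_gt0 ?mulr_gt0 ?addr_gt0.
have -> : ell t = - ln ((y ^+ 2)^-1) / 2.
  rewrite /ell /kappa /y; congr (- ln _ / _).
  move: (sqr_sqrtr (ltW t0)) s0; move: (Num.sqrt t) => s <- s0.
  by field; rewrite !gt_eqF // addr_gt0 // exprn_gt0.
rewrite lnV ?posrE ?exprn_gt0 // lnXn // opprK.
by rewrite -[_ *+ 2]mulr_natr mulfK.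
Qed.

Lemma is_derive_kappa t : 0 < t -> is_derive t 1 kappa (dkappa t).
Proof.
move=> t0; have t1 : 1 + t != 0 by rewrite gt_eqF ?addr_gt0.
have t2 : (1 + t) ^+ 2 != 0 by rewrite expf_neq0.
have dV := is_deriveV (f := fun x => (1 + x) ^+ 2) t2.
apply: is_derive_eq.
rewrite /dkappa /GRing.scale /=; field.
by rewrite t1.
Qed.

Lemma is_derive_ell t : 0 < t -> is_derive t 1 ell (- dkappa t / (2 * kappa t)).
Proof.
move=> t0; have dk := is_derive_kappa t t0; have k0 := kappa_gt0 t t0.
have dl := is_derive1_ln k0.
rewrite /ell.
apply: is_derive_eq.
rewrite /GRing.scale /=; field.
by rewrite gt_eqF.
Qed.

(** Repeated integration by parts of ell^k kappa^n kappa': as ell' = - kappa' / (2 kappa), each step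
    lowers [k] by one and leaves the factor k / (2(n+1)). *)
Fixpoint ell_kappa_primitive n k t : R :=
  if k is k'.+1 then
    kappa t ^+ n.+1 / n.+1%:R * ell t ^+ k +
    k%:R / (2 * n.+1%:R) * ell_kappa_primitive n k' t
  else kappa t ^+ n.+1 / n.+1%:R.

Lemma is_derive_ell_kappa_primitive n k t : 0 < t ->
  is_derive t 1 (ell_kappa_primitive n k)
            (ell t ^+ k * kappa t ^+ n * dkappa t).
Proof.
move=> t0; have dk := is_derive_kappa t t0; have dl := is_derive_ell t t0.
have k0 := kappa_gt0 t t0.
have n0 : n.+1%:R != 0 :> R by rewrite pnatr_eq0.
have d0 : is_derive t 1 (fun x => kappa x ^+ n.+1 / n.+1%:R)
    (kappa t ^+ n * dkappa t).
  have -> : (fun x => kappa x ^+ n.+1 / n.+1%:R) = n.+1%:R^-1 *: (kappa ^+ n.+1).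
    by apply/funext => x; rewrite mulrC [in RHS]fctE.
  apply: is_derive_eq; rewrite /GRing.scale /=.
  field.
  by rewrite addrC natr1.
elim: k => [|k IH]; first by rewrite expr0 mul1r; exact: d0.
have dX : is_derive t 1 (fun x => ell x ^+ k.+1)
    (k.+1%:R * ell t ^+ k * (- dkappa t / (2 * kappa t))).
  have -> : (fun x => ell x ^+ k.+1) = ell ^+ k.+1.
    by apply/funext => x; rewrite fctE.
  exact: is_deriveX.
have e : ell_kappa_primitive n k.+1 =
    (fun x => kappa x ^+ n.+1 / n.+1%:R) * (fun x => ell x ^+ k.+1) +
    (k.+1%:R / (2 * n.+1%:R)) *: ell_kappa_primitive n k.
  by apply/funext => x; rewrite !fctE /GRing.scale.
rewrite e.
have D := is_deriveD (is_deriveM d0 dX) (is_deriveZ (k.+1%:R / (2 * n.+1%:R)) IH).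
apply: (is_derive_eq D); rewrite /GRing.scale /= !exprS.
by field; rewrite nat1r pnatr_eq0 lt0r_neq0.
Qed.

Lemma ell_kappa_primitive1 n k :
  ell_kappa_primitive n k 1 = k`!%:R / (n.+1%:R * (2 * n.+1%:R) ^+ k).
Proof.
have k1 : kappa 1 = 1 by rewrite /kappa -[1 + 1]/2%:R -natrX mulr1 divff.
have l1 : ell 1 = 0 by rewrite /ell k1 ln1 oppr0 mul0r.
elim: k => [|k IH] /=; first by rewrite k1 expr1n expr0 mulr1.
rewrite IH k1 l1 expr0n /= mulr0 add0r factS natrM exprS.
by field; rewrite nat1r pnatr_eq0 expf_neq0 // mulf_neq0.
Qed.

(** The exponential series gives ell^k <= k! exp(ell), and exp(ell) = (1+t) / (2 sqrt t) grows only
    like the inverse square root of [kappa]. *)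
Lemma kappa_ell_le k t : 0 < t -> kappa t * ell t ^+ k <= k`!%:R * (2 * Num.sqrt t).
Proof.
move=> t0; have l0 := ell_ge0 t t0; have k0 := kappa_gt0 t t0.
have s0 : 0 < Num.sqrt t by rewrite sqrtr_gt0.
have t1 : 0 < 1 + t by rewrite addr_gt0.
have lk : ell t ^+ k <= k`!%:R * expR (ell t).
  case: k => [|k]; first by rewrite expr0 mul1r -expR0 ler_expR.
  rewrite mulrC -ler_pdivrMr ?ltr0n ?fact_gt0 //.
  by apply: le_trans (expR_ge1Dxn k l0); rewrite lerDr.
apply: (le_trans (ler_wpM2l (ltW k0) lk)).
rewrite mulrCA ler_wpM2l // ellE // lnK ?posrE ?divr_gt0 ?mulr_gt0 //.
rewrite /kappa -[X in 4 * X](sqr_sqrtr (ltW t0)).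
move: (Num.sqrt t) s0 => s s0.
have -> : 4 * s ^+ 2 / (1 + t) ^+ 2 * ((1 + t) / (2 * s)) = 2 * s / (1 + t).
  by field; rewrite !gt_eqF.
by rewrite ler_pdivrMr // ler_peMr ?mulr_ge0 ?(ltW s0) // lerDl ltW.
Qed.

Lemma ell_kappa_primitive_ge0 n k t : 0 < t -> 0 <= ell_kappa_primitive n k t.
Proof.
move=> t0; have k0 := ltW (kappa_gt0 t t0); have l0 := ell_ge0 t t0.
elim: k => [|k IH] /=; first by rewrite divr_ge0 ?exprn_ge0.
by rewrite addr_ge0 // ?mulr_ge0 ?divr_ge0 ?invr_ge0 ?mulr_ge0 ?exprn_ge0.
Qed.

(** With nonnegativity this forces the primitive to tend to 0 at 0 from the right, where [ell] is
    unbounded. *)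
Lemma ell_kappa_primitive_le n k : exists2 c : R, 0 <= c &
  forall t, 0 < t -> ell_kappa_primitive n k t <= c * Num.sqrt t.
Proof.
have base : forall i t, 0 < t ->
    kappa t ^+ n.+1 / n.+1%:R * ell t ^+ i <= i`!%:R * 2 * Num.sqrt t.
  move=> i t t0; rewrite -[leRHS]mulrA; apply: le_trans (kappa_ell_le i t t0).
  have k0 := ltW (kappa_gt0 t t0); have l0 := ell_ge0 t t0.
  rewrite ler_wpM2r ?exprn_ge0 // ler_pdivrMr ?ltr0n // exprS ler_wpM2l //.
  by rewrite (le_trans (exprn_ile1 _ k0 (kappa_le1 t t0))) // ler1n.
elim: k => [|k [c c0 IH]].
  exists 2 => // t t0; have := base 0%N t t0.
  by rewrite expr0 mulr1 mul1r.
exists (k.+1`!%:R * 2 + k.+1%:R / (2 * n.+1%:R) * c).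
  by rewrite addr_ge0 ?mulr_ge0 ?invr_ge0 ?mulr_ge0.
move=> t t0; rewrite mulrDl /=; apply: lerD; first exact: base.
by rewrite -[leRHS]mulrA ler_wpM2l ?IH // divr_ge0 ?mulr_ge0.
Qed.

Lemma derivable_ell_kappa n k t : 0 < t ->
  derivable (fun x => ell x ^+ k * kappa x ^+ n * dkappa x) t 1.
Proof.
move=> t0; have [dk _] := is_derive_kappa t t0; have [dl _] := is_derive_ell t t0.
have t1 : 1 + t != 0 by rewrite gt_eqF ?addr_gt0.
have t2 : (1 + t) ^+ 3 != 0 by rewrite expf_neq0.
have dV := is_deriveV (f := fun x => (1 + x) ^+ 3) t2.
have dd : derivable dkappa t 1.
  by apply: derivableM; apply: ex_derive.
have -> : (fun x => ell x ^+ k * kappa x ^+ n * dkappa x) =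
   ell ^+ k * kappa ^+ n * dkappa by apply/funext => x; rewrite !fctE.
apply: derivableM; last exact: dd.
apply: derivableM; apply: derivableX; [exact: dl|exact: dk].
Qed.

Lemma ell_kappa_ge0 n k t : 0 < t <= 1 ->
  0 <= ell t ^+ k * kappa t ^+ n * dkappa t.
Proof.
move=> /andP[t0 t1].
have k0 := ltW (kappa_gt0 t t0); have l0 := ell_ge0 t t0.
have d0 : 0 <= dkappa t.
  by rewrite divr_ge0 ?exprn_ge0 ?mulr_ge0 ?subr_ge0 // ltW // addr_gt0.
by rewrite mulr_ge0 // mulr_ge0 // exprn_ge0.
Qed.

Local Notation mu := (@lebesgue_measure R).

Lemma measurable_ell_kappa n k :
  measurable_fun (`]0, 1[ : set R) (fun x => ell x ^+ k * kappa x ^+ n * dkappa x).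
Proof.
apply: open_continuous_measurable_fun; first exact: interval_open.
move=> x; rewrite inE /= in_itv /= => /andP[x0 _].
exact/differentiable_continuous/derivable1_diffP/derivable_ell_kappa.
Qed.

(** The logarithm is singular at 0, so the fundamental theorem is applied on [1/(m+2), 1] and
    monotone convergence extends the result to the whole interval. Only the value of the primitive
    at 1 survives. *)
Lemma integral_ell_kappa n k :
  (\int[mu]_(t in `]0%R, 1%R[) (ell t ^+ k * kappa t ^+ n * dkappa t)%:E =
   (k`!%:R / (n.+1%:R * (2 * n.+1%:R) ^+ k))%:E)%E.
Proof.
set f := fun t => ell t ^+ k * kappa t ^+ n * dkappa t.
have cf t : 0 < t -> {for t, continuous f}.
  by move=> t0; exact/differentiable_continuous/derivable1_diffP/derivable_ell_kappa.
have mf : measurable_fun (`]0%R, 1%R] : set R) f.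
  apply: (@measurable_funS _ _ _ _ (`]0%R, +oo[ : set R)) => //.
    by apply: subset_itvl; rewrite bnd_simp.
  apply: open_continuous_measurable_fun; first exact: interval_open.
  by move=> x; rewrite inE /= in_itv /= andbT; exact: cf.
pose a m : R := m.+2%:R^-1.
have a0 m : 0 < a m by rewrite invr_gt0.
have a1 m : a m < 1 by rewrite invf_lt1 // ltr1n.
have aU : \bigcup_m `[a m, 1%R]%classic = `]0%R, 1%R]%classic :> set R.
  apply/seteqP; split => x /=.
    by case=> m _ /=; rewrite !in_itv /= => /andP[ax ->]; rewrite (lt_le_trans _ ax).
  rewrite in_itv /= => /andP[x0 x1].
  exists (Num.truncn x^-1) => //=; rewrite in_itv /= x1 andbT.
  rewrite /a -[leRHS]invrK lef_pV2 ?posrE ?invr_gt0 //.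
  apply: ltW; apply: lt_trans (truncnS_gt _) _.
  by rewrite ltr_nat.
rewrite integral_itv_bndo_bndc; last first.
  by apply/measurable_EFinP; exact: (measurable_ell_kappa n k).
rewrite -aU -(ell_kappa_primitive1 n k).
have FTC m : (\int[mu]_(t in `[a m, 1%R]) (f t)%:E =
    (ell_kappa_primitive n k 1)%:E - (ell_kappa_primitive n k (a m))%:E)%E.
  apply: continuous_FTC2 => //.
  - apply: continuous_in_subspaceT => x; rewrite inE /= in_itv /= => /andP[ax _].
    by apply: cf; rewrite (lt_le_trans _ ax).
  - have cF t : 0 < t -> {for t, continuous (ell_kappa_primitive n k)}.
      move=> t0; apply/differentiable_continuous/derivable1_diffP.
      by have [] := is_derive_ell_kappa_primitive n k t t0.
    split.
    + move=> x; rewrite in_itv /= => /andP[ax _].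
      by have [] := is_derive_ell_kappa_primitive n k x (lt_trans (a0 m) ax).
    + exact/cvg_at_right_filter/cF.
    + exact/cvg_at_left_filter/cF.
  - move=> x; rewrite in_itv /= => /andP[ax _]; rewrite derive1E.
    by have [] := is_derive_ell_kappa_primitive n k x (lt_trans (a0 m) ax).
have ndI : {homo (fun m => `[a m, 1%R]%classic : set R) : i l / (i <= l)%N >-> (i <= l)%O}.
  move=> i l il; apply/subsetPset; apply: subset_itvr; rewrite bnd_simp.
  by rewrite /a lef_pV2 ?posrE // ler_nat.
have sub m : `[a m, 1%R]%classic `<=` (`]0%R, 1%R]%classic : set R).
  by apply: subset_itvr; rewrite bnd_simp.
have f0 m x : `[a m, 1%R]%classic x -> (0 <= (f x)%:E)%E.
  rewrite /= in_itv /= => /andP[ax x1]; have x0 := lt_le_trans (a0 m) ax.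
  by rewrite lee_fin ell_kappa_ge0 // x0.
have I : ((\int[mu]_(t in `[a m, 1%R]) (f t)%:E) @[m --> \oo] -->
    \int[mu]_(t in \bigcup_m `[a m, 1%R]%classic) (f t)%:E)%E.
  apply: ge0_nondecreasing_set_cvg_integral => //.
  by move=> i; apply/measurable_EFinP; apply: measurable_funS mf.
apply: (cvg_unique (@ereal_hausdorff R) I).
rewrite (_ : (fun m => _) = (fun m => (ell_kappa_primitive n k 1 -
    ell_kappa_primitive n k (a m))%:E)); last by apply/funext => m; exact: FTC.
apply: cvg_EFin; first by apply: nearW.
rewrite -[X in _ --> X]subr0; apply: cvgB; first exact: cvg_cst.
have [c c0 cP] := ell_kappa_primitive_le n k.
apply: (@squeeze_cvgr _ _ _ _ (fun=> 0) (fun m => c * Num.sqrt (a m))).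
- by apply: nearW => m; rewrite ell_kappa_primitive_ge0 // cP.
- exact: cvg_cst.
rewrite -(mulr0 c); apply: cvgMr; rewrite -(@sqrtr0 R).
apply: continuous_cvg; first exact: sqrt_continuous.
have := @cvg_harmonic R; rewrite -(cvg_shiftS (fun m => m.+1%:R^-1 : R)); exact.
Qed.

End logarithmic_beta_integral.

(** * Passage from series to integrals by Tonelli's theorem *)

Lemma cvg_series_EFin (R : realType) (f : R^nat) (l : R) :
  series f @ \oo --> l -> (\sum_(n <oo) (f n)%:E)%E = l%:E.
Proof.
move=> fl; apply/cvg_lim => //.
apply: cvg_EFin; first by apply: nearW => n; rewrite sumEFin.
by rewrite (_ : _ \o _ = series f) //; apply/funext => n /=; rewrite sumEFin.
Qed.

Section summation.
Context {R : realType}.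
Implicit Types (t : R) (n m p k j : nat).

Local Notation mu := (@lebesgue_measure R).

(** The generating function with offset p+1 has no term of index 0; multiplied by kappa'/kappa it
    leaves t^(p+1)/t. *)
Lemma kappa_bin_eseries p t : 0 < t < 1 ->
  (\sum_(n <oo) ('C(2 * n.+1, n.+1 + p.+1)%:R / 4 ^+ n.+1 *
     (kappa t ^+ n * dkappa t))%:E)%E = (t ^+ p)%:E.
Proof.
move=> /andP[t0 t1]; have t01 : 0 < t < 1 by rewrite t0.
have tp : 0 < 1 + t by lra.
have tm : 0 < 1 - t by lra.
have k0 := kappa_gt0 t t0.
set x := t / (1 + t) ^+ 2.
have xk : kappa t = 4 * x by rewrite /kappa /x mulrA.
have x0 : 0 <= x by rewrite divr_ge0 ?exprn_ge0 ?ltW.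
have x1 : 4 * x < 1.
  rewrite /x mulrA ltr_pdivrMr ?exprn_gt0 // mul1r.
  by have : 0 < (1 - t) ^+ 2 by [rewrite exprn_gt0]; nra.
pose u n : R := 'C(2 * n, n + p.+1)%:R * x ^+ n.
have cu : series u @ \oo --> t ^+ p.+1 * ((1 + t) / (1 - t)).
  by rewrite -(bin_seriesE t p.+1 t01); exact: (is_cvg_bin_series x p.+1 x0 x1).
apply: cvg_series_EFin.
have -> : series (fun n => 'C(2 * n.+1, n.+1 + p.+1)%:R / 4 ^+ n.+1 *
     (kappa t ^+ n * dkappa t)) = (fun N => dkappa t / kappa t * series u N.+1).
  apply/funext => N; rewrite /series /= big_nat_recl //.
  rewrite {1}/u bin_small // mul0r add0r mulr_sumr; apply: eq_bigr => n _.
  rewrite /u xk.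
  have xx : x != 0 by apply: contraTneq k0 => x00; rewrite xk x00 mulr0 ltxx.
  rewrite exprMn !exprS; field.
  by rewrite xx expf_neq0.
have -> : t ^+ p = dkappa t / kappa t * (t ^+ p.+1 * ((1 + t) / (1 - t))).
  by rewrite exprS /dkappa /kappa; field; rewrite !gt_eqF.
by apply: cvgMr; rewrite (cvg_shiftS (series u)).
Qed.

(** Expand t^p by [kappa_bin_eseries] and integrate termwise; the factor 2^k / k! cancels the
    constants of [integral_ell_kappa] and leaves 1/(n+1)^(k+1). *)
Lemma bin_eseries_integral p k :
  (\sum_(n <oo) ('C(2 * n.+1, n.+1 + p.+1)%:R / (4 ^+ n.+1 * n.+1%:R ^+ k.+1))%:E =
   (2 ^+ k / k`!%:R)%:E * \int[mu]_(t in `]0%R, 1%R[) (ell t ^+ k * t ^+ p)%:E)%E.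
Proof.
have c0 n : 0 <= 'C(2 * n.+1, n.+1 + p.+1)%:R / 4 ^+ n.+1 :> R.
  by rewrite divr_ge0 // exprn_ge0.
have I : (\int[mu]_(t in `]0%R, 1%R[) (ell t ^+ k * t ^+ p)%:E =
   \int[mu]_(t in `]0%R, 1%R[) \sum_(n <oo)
     (('C(2 * n.+1, n.+1 + p.+1)%:R / 4 ^+ n.+1)%:E *
      (ell t ^+ k * kappa t ^+ n * dkappa t)%:E))%E.
  apply: eq_integral => t; rewrite inE /= in_itv /= => t01.
  rewrite EFinM -(kappa_bin_eseries p t t01) -nneseriesZl; last first.
    move=> n _; have /andP[t0 t1] := t01; rewrite lee_fin mulr_ge0 //.
    by have := ell_kappa_ge0 n 0 t; rewrite expr0 mul1r; apply; rewrite t0 ltW.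
  by apply: eq_eseriesr => n _; rewrite -!EFinM; congr (_%:E); ring.
rewrite I integral_nneseries //; last 2 first.
- move=> n; apply: measurable_funeM; apply/measurable_EFinP.
  exact: (measurable_ell_kappa n k).
- move=> n t; rewrite /= in_itv /= => /andP[t0 t1].
  by rewrite mule_ge0 ?lee_fin // ell_kappa_ge0 // t0 ltW.
rewrite -nneseriesZl; last first.
  move=> n _; apply: integral_ge0 => t; rewrite /= in_itv /= => /andP[t0 t1].
  by rewrite mule_ge0 ?lee_fin // ell_kappa_ge0 // t0 ltW.
apply: eq_eseriesr => n _.
rewrite ge0_integralZl ?lee_fin //; last 2 first.
- by apply/measurable_EFinP; exact: (measurable_ell_kappa n k).
- by move=> t; rewrite /= in_itv /= => /andP[t0 t1]; rewrite lee_fin ell_kappa_ge0 // t0 ltW.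
rewrite integral_ell_kappa -!EFinM; congr (_%:E).
rewrite exprMn [_ ^+ k.+1]exprS.
have a0 : 4 ^+ n.+1 != 0 :> R by rewrite expf_neq0.
have b0 : n.+1%:R != 0 :> R by rewrite pnatr_eq0.
have d0 : k`!%:R != 0 :> R by rewrite pnatr_eq0 -lt0n fact_gt0.
have e0 : 2 ^+ k != 0 :> R by rewrite expf_neq0.
have f0 := expf_neq0 k b0.
move: a0 b0 d0 e0 f0; move: (4 ^+ _) (2 ^+ k) (k`!%:R) => a e d.
move: (_ ^+ k) => f; move: n.+1%:R => b a0 b0 d0 e0 f0.
by field; rewrite a0 b0 d0 e0 f0.
Qed.


Lemma legendre_chi_eseries j t : 0 < t < 1 ->
  ((legendre_chi (2 * j) t)%:E =
   \sum_(m <oo) (t ^+ (2 * m).+1 / (2 * m).+1%:R ^+ (2 * j))%:E)%E.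
Proof.
move=> /andP[t0 t1].
pose f m : R := t ^+ (2 * m).+1 / (2 * m).+1%:R ^+ (2 * j).
have f0 m : 0 <= f m by rewrite divr_ge0 ?exprn_ge0 // ltW.
have cf : cvgn (series f).
  apply: (@series_le_cvg _ _ (geometric 1 t)) => //.
  - by move=> n /=; rewrite mul1r exprn_ge0 // ltW.
  - move=> n /=; rewrite mul1r ler_pdivrMr ?exprn_gt0 //.
    rewrite -[leLHS]mulr1; apply: ler_pM; rewrite ?exprn_ge0 ?(ltW t0) //.
      by apply: ler_wiXn2l; rewrite ?(ltW t0) ?(ltW t1) //; lia.
    by rewrite exprn_ege1 // ler1n.
  - by apply: is_cvg_geometric_series; rewrite ger0_norm // ltW.
rewrite (cvg_series_EFin _ f (limn (series f))) //; congr (_%:E).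
(* The defining sum runs over 1 <= n < N, so its value at N+1 is the N-th partial sum in m = n -
   1. *)
apply/cvg_lim => //; rewrite -cvg_shiftS.
rewrite (_ : (fun n => _) = series f) //; apply/funext => n.
rewrite big_add1 /= /series /=; apply: eq_bigr => m _.
by rewrite /f; congr (_ ^+ _ / _%:R ^+ _); lia.
Qed.

(* The exponent called [k] in the theorem is [k.+1] here, its index [n] is
   [n.+1], and the odd number [p] is [2 m + 1]. *)
Definition dterm k j n m : R := 4 * 'C(2 * n.+1, n.+1 + (2 * m).+1)%:R /
  (4 ^+ n.+1 * n.+1%:R ^+ k.+1 * (2 * m).+1%:R ^+ (2 * j)).

Lemma dterm_ge0 k j n m : 0 <= dterm k j n m.
Proof. by rewrite /dterm divr_ge0 ?mulr_ge0 ?exprn_ge0. Qed.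

(** The binomial vanishes for m > n, so the row is finite. Cutting it at [n.+1] matches
    [nested_sum_bounded] with [B = n.+1], which is [nested_sum] by definition. *)
Lemma sum_dterm_row k j n : (\sum_(m <oo) (dterm k j n m)%:E)%E =
  ('C(2 * n.+1, n.+1)%:R / (n.+1%:R ^+ k.+1 * 4 ^+ n.+1) *
     nested_sum R j n.+1)%:E.
Proof.
rewrite (nneseries_split 0 n.+1); last by move=> m _; rewrite lee_fin dterm_ge0.
rewrite add0n [X in (_ + X)%E]eseries0 ?adde0; last first.
  by move=> m nm _; rewrite /dterm bin_small ?mulr0 ?mul0r //; lia.
rewrite sumEFin big_mkord; congr (_%:E).
rewrite mulrAC (nested_sum_bounded_closed R n.+1 j n.+1) // mulr_sumr.
rewrite mulr_suml; apply: eq_bigr => m _; rewrite /dterm.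
by rewrite mulrA [in RHS]mulrC; rewrite !invfM; ring.
Qed.

Lemma measurable_ell_exp k p :
  measurable_fun (`]0, 1[ : set R) (fun t => ell t ^+ k * t ^+ p).
Proof.
apply: measurable_funM; last exact: measurable_funX.
apply: measurable_funX.
apply: open_continuous_measurable_fun; first exact: interval_open.
move=> x; rewrite inE /= in_itv /= => /andP[x0 _].
apply/differentiable_continuous/derivable1_diffP.
by have [] := is_derive_ell x x0.
Qed.

Lemma sum_dterm_col k j m : (\sum_(n <oo) (dterm k j n m)%:E =
  (2 ^+ k.+2 / k`!%:R)%:E *
   \int[mu]_(t in `]0%R, 1%R[)
     (ell t ^+ k * t ^+ (2 * m) / (2 * m).+1%:R ^+ (2 * j))%:E)%E.
Proof.
have d0 : 0 <= (2 * m).+1%:R ^- (2 * j) :> R by rewrite invr_ge0 exprn_ge0.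
have -> : (\int[mu]_(t in `]0%R, 1%R[)
     (ell t ^+ k * t ^+ (2 * m) / (2 * m).+1%:R ^+ (2 * j))%:E =
   ((2 * m).+1%:R ^- (2 * j))%:E *
     \int[mu]_(t in `]0%R, 1%R[) (ell t ^+ k * t ^+ (2 * m))%:E)%E.
  rewrite -ge0_integralZl ?lee_fin //.
  - by apply: eq_integral => t _; rewrite -EFinM [in RHS]mulrC.
  - by apply/measurable_EFinP; exact: (measurable_ell_exp k (2 * m)).
  - move=> t; rewrite /= in_itv /= => /andP[t0 t1].
    by rewrite lee_fin mulr_ge0 // exprn_ge0 ?ell_ge0 // ltW.
rewrite muleCA; have -> : (2 ^+ k.+2 / k`!%:R)%:E = (4%:E * (2 ^+ k / k`!%:R)%:E)%E :> \bar R.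
  by rewrite -EFinM !exprS; congr EFin; ring.
rewrite -muleA -bin_eseries_integral muleA -EFinM -nneseriesZl; last first.
  by move=> n _; rewrite lee_fin divr_ge0 ?mulr_ge0 ?exprn_ge0.
by apply: eq_eseriesr => n _; rewrite -EFinM /dterm !invfM; congr (_%:E); ring.
Qed.

Lemma chi_integrandE j k t : 0 < t < 1 ->
  ((chi_integrand j k.+1 t)%:E =
   \sum_(m <oo) (ell t ^+ k * t ^+ (2 * m) / (2 * m).+1%:R ^+ (2 * j))%:E)%E.
Proof.
move=> t01; have /andP[t0 t1] := t01.
rewrite /chi_integrand -ellE //= mulrAC EFinM legendre_chi_eseries // -nneseriesZl.
  apply: eq_eseriesr => m _; rewrite -EFinM exprS; congr (_%:E).
  by field; rewrite (gt_eqF t0) expf_neq0 // nat1r pnatr_eq0.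
by move=> m _; rewrite lee_fin divr_ge0 ?exprn_ge0 // ltW.
Qed.

Lemma chi_integrand_ge0 j k t : 0 < t < 1 -> 0 <= chi_integrand j k.+1 t.
Proof.
move=> t01; have /andP[t0 t1] := t01.
rewrite -lee_fin chi_integrandE //; apply: nneseries_ge0 => m _ _.
by rewrite lee_fin divr_ge0 ?mulr_ge0 ?exprn_ge0 ?ell_ge0 // ltW.
Qed.

(** On the open interval the integrand is a series of nonnegative measurable functions. *)
Lemma measurable_chi_integrand j k :
  measurable_fun (`]0, 1[ : set R) (chi_integrand j k.+1).
Proof.
apply/measurable_EFinP.
apply: (@eq_measurable_fun _ _ _ _ _ (fun t => \sum_(m <oo | m \in xpredT)
   (ell t ^+ k * t ^+ (2 * m) / (2 * m).+1%:R ^+ (2 * j))%:E)%E).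
  by move=> t; rewrite inE /= in_itv /= => t01; rewrite chi_integrandE.
apply: ge0_emeasurable_sum => m.
  move=> t; rewrite /= in_itv /= => /andP[t0 t1] _.
  by rewrite lee_fin divr_ge0 ?mulr_ge0 ?exprn_ge0 ?ell_ge0 // ltW.
move=> _; apply/measurable_EFinP; apply: measurable_funM => //.
exact: measurable_ell_exp.
Qed.

Lemma integral_chi_integrand j k :
  ((2 ^+ k.+2 / k`!%:R)%:E *
     \int[mu]_(t in `]0%R, 1%R[) (chi_integrand j k.+1 t)%:E =
   \sum_(m <oo) \sum_(n <oo) (dterm k j n m)%:E)%E.
Proof.
have -> : (\int[mu]_(t in `]0%R, 1%R[) (chi_integrand j k.+1 t)%:E =
   \int[mu]_(t in `]0%R, 1%R[) \sum_(m <oo)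
     (ell t ^+ k * t ^+ (2 * m) / (2 * m).+1%:R ^+ (2 * j))%:E)%E.
  by apply: eq_integral => t; rewrite inE /= in_itv /= => t01; rewrite chi_integrandE.
have pos m t : (`]0%R, 1%R[%classic : set R) t ->
    (0 <= (ell t ^+ k * t ^+ (2 * m) / (2 * m).+1%:R ^+ (2 * j))%:E)%E.
  rewrite /= in_itv /= => /andP[t0 t1].
  by rewrite lee_fin divr_ge0 ?mulr_ge0 ?exprn_ge0 ?ell_ge0 // ltW.
rewrite integral_nneseries //; last first.
  move=> m; apply/measurable_EFinP; apply: measurable_funM => //.
  exact: measurable_ell_exp.
rewrite -nneseriesZl; last by move=> m _; apply: integral_ge0 => t; exact: pos.
by apply: eq_eseriesr => m _; rewrite sum_dterm_col.
Qed.

(** * Finiteness of the double series *)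

(** Telescoping: 1/(2N+1)^2 is at most 2/(N+1) - 2/(N+2), because (N+1)(N+2) <= 2(2N+1)^2. *)
Lemma sum_inv_odd_sqr_le N :
  \sum_(m < N) (2 * m).+1%:R ^- 2 <= 2 * (1 - N.+1%:R^-1) :> R.
Proof.
elim: N => [|N IH]; first by rewrite big_ord0 invr1 subrr mulr0.
rewrite big_ord_recr /= -lerBrDr (le_trans IH) //.
have a0 : 0 < N.+1%:R :> R by rewrite ltr0n.
have b0 : 0 < N.+2%:R :> R by rewrite ltr0n.
have c0 : 0 < (2 * N).+1%:R :> R by rewrite ltr0n.
rewrite lerBrDr -subr_ge0.
have -> : 2 * (1 - N.+2%:R^-1) - (2 * (1 - N.+1%:R^-1) + (2 * N).+1%:R ^- 2) =
   (2 * (2 * N).+1%:R ^+ 2 - N.+1%:R * N.+2%:R) /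
   (N.+1%:R * N.+2%:R * (2 * N).+1%:R ^+ 2) :> R.
  have e1 : N.+2%:R = N.+1%:R + 1 :> R by rewrite natr1.
  have e2 : (2 * N).+1%:R = 2 * N.+1%:R - 1 :> R.
    by rewrite -natr1 natrM -[N.+1%:R]natr1; ring.
  rewrite e1 e2 in b0 c0 *; move: a0 b0 c0; move: N.+1%:R => a a0 b0 c0.
  field.
  by rewrite !gt_eqF.
rewrite divr_ge0 ?mulr_ge0 ?exprn_ge0 // subr_ge0.
by rewrite -natrX -!natrM ler_nat; nia.
Qed.

(** The terms are largest for the smallest exponents, [k = 0] and [j = 1]. There the logarithm
    disappears from [sum_dterm_col], and bounding t^(2m) by 1 leaves 4/(2m+1)^2, whose sum is at
    most 8. *)
Lemma sum_dterm_lty k j : (0 < j)%N ->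
  (\sum_(m <oo) \sum_(n <oo) (dterm k j n m)%:E < +oo)%E.
Proof.
move=> j0.
have le m : (\sum_(n <oo) (dterm k j n m)%:E <= (4 * (2 * m).+1%:R ^- 2)%:E)%E.
  have le0 : (\sum_(n <oo) (dterm k j n m)%:E <= \sum_(n <oo) (dterm 0 1 n m)%:E)%E.
    apply: lee_nneseries => [n _ _|n _]; rewrite lee_fin ?dterm_ge0 // /dterm.
    rewrite ler_wpM2l ?mulr_ge0 // lef_pV2 ?posrE ?mulr_gt0 ?exprn_gt0 //.
    rewrite -!natrX -!natrM ler_nat -!mulnA leq_mul2l; apply/orP; right.
    by apply: leq_mul; apply: leq_pexp2l => //; lia.
  apply: (le_trans le0); rewrite sum_dterm_col fact0 divr1 (_ : 2 ^+ 2 = 4 :> R) ?EFinM //; last first.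
    by rewrite -natrX.
  rewrite lee_wpmul2l ?lee_fin //.
  have <- : (\int[mu]_(t in `]0%R, 1%R[) cst ((2 * m).+1%:R ^- 2)%:E t =
      ((2 * m).+1%:R ^- 2)%:E)%E.
    rewrite integral_cst //= lebesgue_measure_itv /= lte_fin ltr01.
    by rewrite oppr0 adde0 mule1.
  apply: ge0_le_integral => //.
  - move=> t; rewrite /= in_itv /= => /andP[t0 t1].
    by rewrite lee_fin divr_ge0 ?mulr_ge0 ?exprn_ge0 ?ell_ge0 // ltW.
  - apply/measurable_EFinP; apply: measurable_funM => //.
    exact: measurable_ell_exp.
  - move=> t; rewrite /= in_itv /= => /andP[t0 t1].
    rewrite lee_fin expr0 mul1r muln1 ler_piMl ?invr_ge0 ?exprn_ge0 //.
    by rewrite exprn_ile1 // ltW.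
apply: (@le_lt_trans _ _ (8%:E)); last exact: ltry.
apply: (le_trans (lee_nneseries _ (fun m _ => le m))).
  by move=> m _ _; apply: nneseries_ge0 => n _ _; rewrite lee_fin dterm_ge0.
apply: lime_le.
  by apply: is_cvg_nneseries => m _ _; rewrite lee_fin mulr_ge0 // invr_ge0 exprn_ge0.
apply: nearW => N; rewrite sumEFin lee_fin big_mkord -mulr_sumr.
have -> : 8 = 4 * 2 :> R by rewrite -natrM.
rewrite ler_wpM2l // (le_trans (sum_inv_odd_sqr_le N)) //.
by rewrite -[leRHS]mulr1 ler_wpM2l // gerBl invr_ge0.
Qed.

End summation.

(** * Integrability and the value of the series *)

Theorem theorem3p6 (R : realType) (j k : nat)
    (j_gt0 : (0 < j)%N) (k_gt0 : (0 < k)%N) :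
  (@lebesgue_measure R).-integrable `]0, 1[ (EFin \o @chi_integrand R j k) /\
  (fun N : nat =>
     \sum_(1 <= n < N)
       'C(2 * n, n)%:R / (n%:R ^+ k * 4 ^+ n) * nested_sum R j n) @ \oo -->
    2 ^+ k.+1 / (k.-1)`!%:R *
      \int[@lebesgue_measure R]_(t in `]0, 1[) chi_integrand j k t.
Proof.
case: k k_gt0 => // k _ /=.
pose I := (\int[@lebesgue_measure R]_(t in `]0%R, 1%R[) (chi_integrand j k.+1 t)%:E)%E.
have c_gt0 : 0 < 2 ^+ k.+2 / k`!%:R :> R by rewrite divr_gt0 ?exprn_gt0 ?ltr0n ?fact_gt0.
have totalE := @integral_chi_integrand R j k.
have I_ge0 : (0 <= I)%E.
  apply: integral_ge0 => t; rewrite /= in_itv /= => t01.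
  by rewrite lee_fin chi_integrand_ge0.
(* An infinite [I] times the positive constant would make the double series infinite. *)
have I_lty : (I < +oo)%E.
  have := @sum_dterm_lty R k j j_gt0; rewrite -totalE -/I.
  by rewrite !ltey; apply: contra => /eqP ->; rewrite gt0_muley ?lte_fin.
have I_fin : I \is a fin_num by rewrite ge0_fin_numE.
split.
  apply/integrableP; split.
    by apply/measurable_EFinP; exact: measurable_chi_integrand.
  rewrite (_ : (\int[_]_(t in _) _)%E = I) //; apply: eq_integral => t.
  rewrite inE /= in_itv /= => t01; rewrite ger0_norm //.
  exact: chi_integrand_ge0.
rewrite /Rintegral -/I -cvg_shiftS.
pose a n : R := 'C(2 * n.+1, n.+1)%:R / (n.+1%:R ^+ k.+1 * 4 ^+ n.+1) * nested_sum R j n.+1.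
have a_ge0 n : (0 <= (a n)%:E)%E.
  rewrite /a -sum_dterm_row; apply: nneseries_ge0 => m _ _.
  by rewrite lee_fin dterm_ge0.
have sumE : (\sum_(n <oo) (a n)%:E = (2 ^+ k.+2 / k`!%:R * fine I)%:E)%E.
  (* Nonnegative terms may be summed in either order: the integral gives the sum by columns, the
     nested sums give it by rows. *)
  rewrite EFinM fineK // totalE nneseries_interchange.
    by apply: eq_eseriesr => n _; rewrite sum_dterm_row.
  by move=> m n; rewrite lee_fin dterm_ge0.
(* The extended-real partial sums converge to a finite limit, so their real parts converge to the
   same value. *)
have /cvg_ex[l] := is_cvg_nneseries (P := xpredT) (N := 0) (fun n _ _ => a_ge0 n).
move=> /[dup] /(cvg_lim (@ereal_hausdorff R)) <-; rewrite sumE => /fine_cvgP[_].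
apply: cvg_trans; apply: near_eq_cvg; apply: nearW => N /=.
by rewrite big_add1 /= sumEFin.
Qed.
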